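(* Let $A$ be a unitary $*$-algebra of the type $F+J(A)$ over a field $F$ of characteristic zero, generating a variety with quadratic codimension growth. For the multiplicities $m_{((1)_{0^-},(1)_{1^+})}$, $m_{((1)_{1^+},(1)_{1^-})}$ and $m_{((1)_{0^-},(1)_{1^-})}$ in the proper cocharacters of $A$, we have: (1) If $m_{((1)_{0^-},(1)_{1^+})}=1$ then $\mathcal{G}_{2,\gamma}^{gri} \in \mathrm{var}^*(A)$ or $W_{\eta_1}^{gri} \in \mathrm{var}^*(A)$. (2) If $m_{((1)_{1^+},(1)_{1^-})}=1$ then $\mathcal{G}_{2,\gamma}^{gr} \in \mathrm{var}^*(A)$ or $W_{\eta_2}^{gr} \in \mathrm{var}^*(A)$. (3) If $m_{((1)_{0^-},(1)_{1^-})}=1$ then $\mathcal{G}_{2,\tau}^{gri} \in \mathrm{var}^*(A)$ or $W_{\eta_3}^{gri} \in \mathrm{var}^*(A)$.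
   Context: Throughout, $F$ is a field of characteristic zero and algebras are associative over $F$. A superalgebra is an algebra $A=A_0\oplus A_1$ with $A_iA_j\subseteq A_{i+j}$ (indices mod 2); we also write $A=(A_0,A_1)$. A superinvolution on $A$ is a linear map $*:A\to A$ with $A_i^*\subseteq A_i$, $(a^* )^*=a$ and $(ab)^*=(-1)^{|a||b|}b^*a^*$ for all homogeneous $a,b$. A $*$-algebra is a superalgebra with a superinvolution; it is unitary if it has a unit. Put $A_i^{+}=\{a\in A_i: a^*=a\}$, $A_i^-=\{a\in A_i:a^*=-a\}$. $J(A)$ is the Jacobson radical; ''of the type $F+J(A)$'' means $A=F1_A+J(A)$. Let $\mathcal F$ be the free associative algebra on the disjoint sets $X_i^\varepsilon=\{x_{1,i}^\varepsilon,x_{2,i}^\varepsilon,\dots\}$, $i\in\{0,1\}$, $\varepsilon\in\{+,-\}$, where variables in $X_i^\varepsilon$ have degree $i$ and are symmetric ($\varepsilon=+$) or skew ($\varepsilon=-$). $\mathrm{Id}^*(A)$ is the set of $f\in\mathcal F$ (the $*$-identities) vanishing under all substitutions sending each $x_{j,i}^\varepsilon$ into $A_i^\varepsilon$, and $\mathrm{var}^*(A)$ is the class of all $*$-algebras $B$ with $\mathrm{Id}^*(A)\subseteq\mathrm{Id}^*(B)$. $P_n^*$ is the span of all $w_{\sigma(1)}\cdots w_{\sigma(n)}$, $\sigma\in S_n$, $w_j\in\{x_{j,0}^+,x_{j,0}^-,x_{j,1}^+,x_{j,1}^-\}$, and $c_n^*(A)=\dim_F P_n^*/(P_n^*\cap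 \mathrm{Id}^*(A))$. Quadratic codimension growth means $\lim_{n\to\infty}c_n^*(A)/(\alpha n^2)=1$ for some $\alpha\ne0$. A multilinear polynomial is proper if it is a linear combination of products of variables from $X_0^-$, then variables from $X_1^+$, then variables from $X_1^-$, followed by (left-normed) commutators of length at least 2 in arbitrary variables. For $n=n_1+\cdots+n_4$, $\Gamma_{n_1,\dots,n_4}$ is the space of proper multilinear polynomials of degree $n$ in which the first $n_1$ variables are symmetric of degree 0, the next $n_2$ skew of degree 0, the next $n_3$ symmetric of degree 1, the last $n_4$ skew of degree 1. The group $S_{n_1}\times\cdots\times S_{n_4}$ acts by permuting variables of the same type, and the character of $\Gamma_{n_1,\dots,n_4}(A)=\Gamma_{n_1,\dots,n_4}/(\Gamma_{n_1,\dots,n_4}\cap\mathrm{Id}^*(A))$ decomposes as $\pi_{n_1,\dots,n_4}(A)=\sum m_{\lambda_1,\dots,\lambda_4}\,\chi_{\lambda_1}\otimes\cdots\otimes\chi_{\lambda_4}$, summed over $\lambda_i\vdash n_i$ (the proper cocharacter of $A$). A multipartition is written $((\lambda_1)_{0^+},(\lambda_2)_{0^-},(\lambda_3)_{1^+},(\lambda_4)_{1^-})$ with empty partitions omitted; e.g. $m_{((1)_{0^-},(1)_{1^+})}$ is the multiplicity for $(n_1,\dots,n_4)=(0,1,1,0)$ and $\lambda_2=\lambda_3=(1)$. Algebras. $\mathcal G_2=\langle 1,e_1,e_2\mid e_ie_j=-e_je_i,\ i,j=1,2\rangle$ (basis $1,e_1,e_2,e_1e_2$). Gradings: $\mathcal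 G_2^{gr}=(F1+Fe_1e_2,\,Fe_1+Fe_2)$; $\mathcal G_2^{gri}=(F1+Fe_1,\,Fe_2+Fe_1e_2)$. Superinvolutions determined by $\tau(e_i)=-e_i$, $\gamma(e_i)=(-1)^ie_i$ ($i=1,2$). $\mathcal G_{2,\gamma}^{gr}$ is $\mathcal G_2^{gr}$ with $\gamma$; $\mathcal G_{2,\gamma}^{gri},\mathcal G_{2,\tau}^{gri}$ are $\mathcal G_2^{gri}$ with $\gamma$, resp. $\tau$. $W=\{a(e_{11}+e_{22}+e_{33}+e_{44})+b(e_{12}+e_{34})+c(e_{13}+e_{24})+de_{14}:a,b,c,d\in F\}$ ($e_{ij}$ matrix units). Maps: $\eta_1:(a,b,c,d)\mapsto(a,-b,c,-d)$, $\eta_2:(a,b,c,d)\mapsto(a,-b,c,d)$, $\eta_3:(a,b,c,d)\mapsto(a,-b,-c,d)$. $W_{\eta_2}^{gr}$: grading $(F(e_{11}+\cdots+e_{44})+Fe_{14},\,F(e_{12}+e_{34})+F(e_{13}+e_{24}))$, superinvolution $\eta_2$. $W_{\eta_1}^{gri}$, $W_{\eta_3}^{gri}$: grading $(F(e_{11}+\cdots+e_{44})+F(e_{12}+e_{34}),\,F(e_{13}+e_{24})+Fe_{14})$, superinvolution $\eta_1$, resp. $\eta_3$. *)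

(* Defs.v *)
From HB Require Import structures.
From mathcomp Require Import all_boot all_order all_algebra all_fingroup.
From mathcomp Require Import mxrepresentation.
From mathcomp Require Import classical_sets reals topology normedtype sequences.
From mathcomp Require Import ring.
(* The notations of monalg clash with those of mathcomp-analysis. *)
From mathcomp.multinomials Require Import -(notations) monalg.

Set Implicit Arguments.
Unset Strict Implicit.
Unset Printing Implicit Defensive.

Import GRing.Theory Num.Theory.
Import numFieldNormedType.Exports.
Local Open Scope ring_scope.

(* Degrees live in bool (false = 0, true = 1).  All *-algebras considered are
   unitary, so the carrier is an algType. *)
Record starAlg (F : fieldType) := StarAlg {
  sa_sort :> algType F;
  homog : bool -> sa_sort -> Prop;
  homog0 : forall i, homog i 0;
  homog_lin : forall i (c : F) a b, homog i a -> homog i b -> homog i (c *: a + b);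
  homog_sum : forall a, exists a0 a1, [/\ homog false a0, homog true a1 & a = a0 + a1];
  homog_direct : forall a, homog false a -> homog true a -> a = 0;
  homog_mul : forall i j a b, homog i a -> homog j b -> homog (i (+) j) (a * b);
  star : {linear sa_sort -> sa_sort};
  star_homog : forall i a, homog i a -> homog i (star a);
  starK : involutive star;
  starM : forall i j a b, homog i a -> homog j b ->
    star (a * b) = (-1) ^+ (i && j) * (star b * star a)
}.

(* hsym i e a : a is homogeneous of degree i, symmetric (e = false) or skew
   (e = true). *)
Definition hsym (F : fieldType) (A : starAlg F) (i e : bool) (a : A) : Prop :=
  homog i a /\ star A a = (-1) ^+ e * a.

Section Jacobson.
Variable B : nzRingType.

Definition left_ideal (I : B -> Prop) : Prop :=
  [/\ I 0, forall a b, I a -> I b -> I (a + b) & forall a b, I b -> I (a * b)].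

Definition maximal_left_ideal (I : B -> Prop) : Prop :=
  [/\ left_ideal I, ~ I 1
    & forall L : B -> Prop, left_ideal L -> (forall a, I a -> L a) -> ~ L 1 ->
        forall a, L a -> I a].

Definition Jacobson (a : B) : Prop := forall I, maximal_left_ideal I -> I a.

End Jacobson.

Definition type_F_plus_J (F : fieldType) (A : starAlg F) : Prop :=
  forall a : A, exists (c : F) (j : A), Jacobson j /\ a = c%:A + j.

Section LinearAlgebra.
Variables (F : fieldType) (M : lmodType F).

Definition in_span (S : M -> Prop) (f : M) : Prop :=
  exists (k : nat) (c : 'I_k -> F) (v : 'I_k -> M),
    (forall i, S (v i)) /\ f = \sum_i c i *: v i.

(* v induces a basis of the quotient V / W, for subspaces W of V of M. *)
Definition quotient_basis (V W : M -> Prop) (d : nat) (v : 'I_d -> M) : Prop :=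
  [/\ forall i, V (v i),
      forall u, V u -> exists a : 'I_d -> F, W (u - \sum_i a i *: v i)
    & forall a : 'I_d -> F, W (\sum_i a i *: v i) -> forall i, a i = 0].

Definition quotient_dim (V W : M -> Prop) (d : nat) : Prop :=
  exists v : 'I_d -> M, quotient_basis V W v.

(* chi is the character of the action on V / W induced by act: the trace of the
   matrices of this action in a basis. *)
Definition quotient_character (G : Type) (act : G -> M -> M)
    (V W : M -> Prop) (chi : G -> F) : Prop :=
  exists (d : nat) (v : 'I_d -> M) (rho : G -> 'M[F]_d),
    [/\ quotient_basis V W v,
        forall g j, W (act g (v j) - \sum_i rho g i j *: v i)
      & forall g, chi g = \tr (rho g)].

End LinearAlgebra.

(* A type of variable is a pair (degree, is_skew). *)
Definition vtype : Type := (bool * bool)%type.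
Definition even_sym : vtype := (false, false).
Definition even_skew : vtype := (false, true).
Definition odd_sym : vtype := (true, false).
Definition odd_skew : vtype := (true, true).

(* Indices of variables start from 0. *)
Definition svar : Type := (nat * (bool * bool))%type.
HB.instance Definition _ := Choice.on svar.

Section FreeAlgebra.
Variable F : fieldType.

(* The free unitary associative algebra on the variables. *)
Definition freeAlg := malg (fmonom svar) F.
HB.instance Definition _ := GRing.Lalgebra.on freeAlg.

Definition X (x : svar) : freeAlg := mkmalgU (fmu x) 1.

Definition eval (B : lalgType F) (v : svar -> B) (f : freeAlg) : B :=
  mmap (fun c : F => c%:A) (fun m : fmonom svar => \prod_(x <- (m : seq svar)) v x) f.

Definition star_subst (A : starAlg F) (v : svar -> A) : Prop :=
  forall x : svar, hsym x.2.1 x.2.2 (v x).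

Definition Id_star (A : starAlg F) (f : freeAlg) : Prop :=
  forall v : svar -> A, star_subst v -> eval v f = 0.

Definition in_var (A B : starAlg F) : Prop :=
  forall f, Id_star A f -> Id_star B f.

Definition word (s : seq svar) : freeAlg := \prod_(x <- s) X x.

Definition Pstar (n : nat) : freeAlg -> Prop :=
  in_span (fun f => exists (s : 'S_n) (t : 'I_n -> vtype),
    f = \prod_(i < n) X (val (s i), t (s i))).

Definition star_codim (A : starAlg F) (n d : nat) : Prop :=
  quotient_dim (Pstar n) (fun f => Pstar n f /\ Id_star A f) d.

Definition quadratic_growth (R : realType) (A : starAlg F) : Prop :=
  exists c : nat -> nat, (forall n, star_codim A n (c n)) /\
  exists2 alpha : R, alpha != 0 &
    ((fun n => (c n)%:R / (alpha * n%:R ^+ 2)) @ \oo --> (1 : R))%classic.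

Definition left_normed (s : seq svar) : freeAlg :=
  if s is x :: t then foldl (fun f y => f * X y - X y * f) (X x) t else 0.

Definition proper_product (f : freeAlg) : Prop :=
  exists (u v w : seq svar) (cs : seq (seq svar)),
    [/\ all (fun x => x.2 == even_skew) u,
        all (fun x => x.2 == odd_sym) v,
        all (fun x => x.2 == odd_skew) w,
        all (fun c => 1 < size c)%N cs
      & f = word u * word v * word w * \prod_(c <- cs) left_normed c].

Definition proper : freeAlg -> Prop := in_span proper_product.

(* Multilinear polynomials in exactly the (distinct) variables of s. *)
Definition multilinear (s : seq svar) : freeAlg -> Prop :=
  in_span (fun f => exists2 t, perm_eq t s & f = word t).

Definition gamma_vars (n1 n2 n3 n4 : nat) : seq svar :=
  [seq (i, even_sym) | i <- iota 0 n1] ++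
  [seq (i, even_skew) | i <- iota n1 n2] ++
  [seq (i, odd_sym) | i <- iota (n1 + n2) n3] ++
  [seq (i, odd_skew) | i <- iota (n1 + n2 + n3) n4].

Definition Gamma (n1 n2 n3 n4 : nat) (f : freeAlg) : Prop :=
  multilinear (gamma_vars n1 n2 n3 n4) f /\ proper f.

End FreeAlgebra.

(* The permutation s acting on the interval [k, k + n[. *)
Definition block_perm (k n : nat) (s : 'S_n) (i : nat) : nat :=
  if (k <= i)%N then
    if insub (i - k)%N is Some j then (k + val (s j))%N else i
  else i.

Definition prodS (n1 n2 n3 n4 : nat) : Type := ('S_n1 * 'S_n2 * 'S_n3 * 'S_n4)%type.

Definition rename_var (n1 n2 n3 n4 : nat) (g : prodS n1 n2 n3 n4) (x : svar) : svar :=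
  let: (g1, g2, g3, g4) := g in
  let: (i, t) := x in
  (match t with
   | (false, false) => block_perm 0 g1 i
   | (false, true) => block_perm n1 g2 i
   | (true, false) => block_perm (n1 + n2) g3 i
   | (true, true) => block_perm (n1 + n2 + n3) g4 i
   end, t).

Definition rename (F : fieldType) (n1 n2 n3 n4 : nat) (g : prodS n1 n2 n3 n4)
    (f : freeAlg F) : freeAlg F :=
  eval (fun x => X F (rename_var g x)) f.

Definition is_partition (n : nat) (la : seq nat) : bool :=
  [&& sorted geq la, 0%N \notin la & sumn la == n].

Definition partitions (n : nat) : seq (seq nat) :=
  [seq la <- [seq map val (t : seq 'I_n.+1) | t : {bseq n of 'I_n.+1}]
     | is_partition n la].

Lemma mem_partitions n la : (la \in partitions n) = is_partition n la.
Proof.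
rewrite mem_filter; case E: (is_partition n la) => //=.
move: E => /and3P [_ n0 /eqP sm].
have sz : (size la <= n)%N.
  rewrite -sm; elim: la n0 {sm} => //= a l IH.
  rewrite inE negb_or eq_sym => /andP [a0 /IH h].
  by rewrite -addn1 addnC leq_add // lt0n.
have le x : x \in la -> (x < n.+1)%N.
  rewrite ltnS -sm; elim: la {n0 sm sz} => //= a l IH.
  rewrite inE => /orP [/eqP->|/IH h]; first exact: leq_addr.
  exact: leq_trans h (leq_addl _ _).
have sz' : (size (map (@inord n) la) <= n)%N by rewrite size_map.
apply/mapP; exists (Bseq sz'); first by rewrite mem_enum.
rewrite /= -map_comp -[LHS]map_id; apply/eq_in_map => x /le h /=.
by rewrite inordK.
Qed.

Lemma partitions_uniq n : uniq (partitions n).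
Proof.
apply: filter_uniq; rewrite map_inj_uniq ?enum_uniq // => s t /(inj_map val_inj) h.
exact: val_inj.
Qed.

Section SpechtCharacter.
Variables (F : fieldType) (n : nat) (la : seq nat).

(* Row and column stabilisers of the Young tableau of shape la which is filled
   row by row: reshape_index and reshape_offset give the row and the column in
   which an entry lies. *)
Definition row_stab : {set 'S_n} :=
  [set s : 'S_n | [forall i, reshape_index la (s i) == reshape_index la i]].
Definition col_stab : {set 'S_n} :=
  [set s : 'S_n | [forall i, reshape_offset la (s i) == reshape_offset la i]].

(* The Young symmetrizer of this tableau, in the group algebra of 'S_n. *)
Definition young_sym : 'rV[F]_#|[set: 'S_n]%G| :=
  \sum_(s in row_stab) \sum_(t in col_stab)
    (-1) ^+ (odd_perm t) *: delta_mx 0 (gring_index [set: 'S_n]%G (s * t)%g).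

(* The irreducible character indexed by la, afforded by the ideal of the group
   algebra generated by the Young symmetrizer (a right ideal, since regular_repr
   acts by right multiplication). *)
Definition specht_char (g : 'S_n) : F :=
  \tr (submod_repr (cyclic_mx_module (regular_repr F [set: 'S_n]%G) young_sym) g).

End SpechtCharacter.

(* m gives the multiplicities in the decomposition of the character of
   Gamma_{n1, n2, n3, n4}(A). *)
Definition proper_cocharacter (F : fieldType) (A : starAlg F) (n1 n2 n3 n4 : nat)
    (m : seq nat -> seq nat -> seq nat -> seq nat -> nat) : Prop :=
  quotient_character (@rename F n1 n2 n3 n4) (Gamma n1 n2 n3 n4)
    (fun f => Gamma n1 n2 n3 n4 f /\ Id_star A f)
    (fun g : prodS n1 n2 n3 n4 =>
       let: (g1, g2, g3, g4) := g in
       \sum_(l1 <- partitions n1) \sum_(l2 <- partitions n2)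
       \sum_(l3 <- partitions n3) \sum_(l4 <- partitions n4)
         (m l1 l2 l3 l4)%:R * (specht_char F l1 g1 * specht_char F l2 g2 *
                               specht_char F l3 g3 * specht_char F l4 g4)).

(* The multiplicity m_{(l1)_{0+}, (l2)_{0-}, (l3)_{1+}, (l4)_{1-}} is k. *)
Definition proper_mult (F : fieldType) (A : starAlg F) (l1 l2 l3 l4 : seq nat)
    (k : nat) : Prop :=
  exists2 m, proper_cocharacter A (sumn l1) (sumn l2) (sumn l3) (sumn l4) m
           & m l1 l2 l3 l4 = k.

(* The algebra G_2, in the coordinates 1, e1, e2, e1e2. *)
Record grass (F : Type) := Grass { gc0 : F; gc1 : F; gc2 : F; gc12 : F }.

Definition grass_to (F : Type) (x : grass F) := (gc0 x, gc1 x, gc2 x, gc12 x).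
Definition grass_of (F : Type) (x : F * F * F * F) :=
  let: (a, b, c, d) := x in Grass a b c d.
Lemma grass_toK (F : Type) : cancel (@grass_to F) (@grass_of F).
Proof. by case. Qed.

HB.instance Definition _ (F : choiceType) :=
  Choice.copy (grass F) (can_type (@grass_toK F)).

Section Grassmann.
Variable F : fieldType.
Implicit Types x y z : grass F.

Definition grass_add x y :=
  Grass (gc0 x + gc0 y) (gc1 x + gc1 y) (gc2 x + gc2 y) (gc12 x + gc12 y).
Definition grass_opp x := Grass (- gc0 x) (- gc1 x) (- gc2 x) (- gc12 x).
Definition grass_mul x y :=
  Grass (gc0 x * gc0 y)
        (gc0 x * gc1 y + gc1 x * gc0 y)
        (gc0 x * gc2 y + gc2 x * gc0 y)
        (gc0 x * gc12 y + gc12 x * gc0 y + gc1 x * gc2 y - gc2 x * gc1 y).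
Definition grass_scale (c : F) x :=
  Grass (c * gc0 x) (c * gc1 x) (c * gc2 x) (c * gc12 x).

Lemma grass_addA : associative grass_add.
Proof. by move=> x y z; congr Grass; rewrite /= addrA. Qed.
Lemma grass_addC : commutative grass_add.
Proof. by move=> x y; congr Grass; rewrite addrC. Qed.
Lemma grass_add0 : left_id (Grass 0 0 0 0) grass_add.
Proof. by case=> *; congr Grass; rewrite /= add0r. Qed.
Lemma grass_addN : left_inverse (Grass 0 0 0 0) grass_opp grass_add.
Proof. by move=> x; congr Grass; rewrite /= addNr. Qed.
HB.instance Definition _ := GRing.isZmodule.Build (grass F)
  grass_addA grass_addC grass_add0 grass_addN.

Lemma grass_mulA : associative grass_mul.
Proof. by move=> x y z; congr Grass => /=; ring. Qed.
Lemma grass_mul1 : left_id (Grass 1 0 0 0) grass_mul.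
Proof. by case=> a b c d; congr Grass => /=; ring. Qed.
Lemma grass_mulr1 : right_id (Grass 1 0 0 0) grass_mul.
Proof. by case=> a b c d; congr Grass => /=; ring. Qed.
Lemma grass_mulDl : left_distributive grass_mul +%R.
Proof. by move=> x y z; congr Grass => /=; ring. Qed.
Lemma grass_mulDr : right_distributive grass_mul +%R.
Proof. by move=> x y z; congr Grass => /=; ring. Qed.
Lemma grass_1neq0 : Grass 1 0 0 0 != 0 :> grass F.
Proof. by apply/eqP => -[] /eqP; rewrite oner_eq0. Qed.
HB.instance Definition _ := GRing.Zmodule_isNzRing.Build (grass F)
  grass_mulA grass_mul1 grass_mulr1 grass_mulDl grass_mulDr grass_1neq0.

Lemma grass_scaleA a b x : grass_scale a (grass_scale b x) = grass_scale (a * b) x.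
Proof. by congr Grass => /=; ring. Qed.
Lemma grass_scale1 : left_id 1 grass_scale.
Proof. by case=> *; congr Grass; rewrite /= mul1r. Qed.
Lemma grass_scaleDr : right_distributive grass_scale +%R.
Proof. by move=> a x y; congr Grass => /=; ring. Qed.
Lemma grass_scaleDl x : {morph grass_scale^~ x : a b / a + b}.
Proof. by move=> a b; congr Grass => /=; ring. Qed.
HB.instance Definition _ := GRing.Zmodule_isLmodule.Build F (grass F)
  grass_scaleA grass_scale1 grass_scaleDr grass_scaleDl.

Lemma grass_scaleAl (a : F) (x y : grass F) : a *: (x * y) = a *: x * y.
Proof. by congr Grass => /=; ring. Qed.
HB.instance Definition _ := GRing.Lmodule_isLalgebra.Build F (grass F) grass_scaleAl.
Lemma grass_scaleAr (a : F) (x y : grass F) : a *: (x * y) = x * (a *: y).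
Proof. by congr Grass => /=; ring. Qed.
HB.instance Definition _ := GRing.Lalgebra_isAlgebra.Build F (grass F) grass_scaleAr.

Definition e1 : grass F := Grass 0 1 0 0.
Definition e2 : grass F := Grass 0 0 1 0.

Lemma grass_rel : [/\ e1 * e1 = - (e1 * e1), e2 * e2 = - (e2 * e2)
                    & e1 * e2 = - (e2 * e1)].
Proof. by split; congr Grass => /=; ring. Qed.
Lemma grass_basis x :
  x = gc0 x *: 1 + gc1 x *: e1 + gc2 x *: e2 + gc12 x *: (e1 * e2).
Proof. by case: x => a b c d; congr Grass => /=; ring. Qed.

Definition G2_gr (i : bool) x : Prop :=
  if i then gc0 x = 0 /\ gc12 x = 0 else gc1 x = 0 /\ gc2 x = 0.
Definition G2_gri (i : bool) x : Prop :=
  if i then gc0 x = 0 /\ gc1 x = 0 else gc2 x = 0 /\ gc12 x = 0.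

(* The action on e1e2 is forced by (e1e2)^* = (-1)^{|e1||e2|} e2^* e1^*, so it
   depends on the grading. *)
Definition gamma_gr x := Grass (gc0 x) (- gc1 x) (gc2 x) (- gc12 x).
Definition gamma_gri x := Grass (gc0 x) (- gc1 x) (gc2 x) (gc12 x).
Definition tau_gri x := Grass (gc0 x) (- gc1 x) (- gc2 x) (- gc12 x).

Lemma gamma_gr_linear : linear gamma_gr.
Proof. by move=> c x y; congr Grass => /=; ring. Qed.
HB.instance Definition _ :=
  GRing.isLinear.Build F (grass F) (grass F) *:%R gamma_gr gamma_gr_linear.
Lemma gamma_gri_linear : linear gamma_gri.
Proof. by move=> c x y; congr Grass => /=; ring. Qed.
HB.instance Definition _ :=
  GRing.isLinear.Build F (grass F) (grass F) *:%R gamma_gri gamma_gri_linear.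
Lemma tau_gri_linear : linear tau_gri.
Proof. by move=> c x y; congr Grass => /=; ring. Qed.
HB.instance Definition _ :=
  GRing.isLinear.Build F (grass F) (grass F) *:%R tau_gri tau_gri_linear.

End Grassmann.

Section StarGrassmann.
Variable F : fieldType.

Lemma grassE :
  (forall a b c d a' b' c' d' : F, Grass a b c d + Grass a' b' c' d' =
     Grass (a + a') (b + b') (c + c') (d + d')) *
  (forall a b c d a' b' c' d' : F, Grass a b c d * Grass a' b' c' d' =
     Grass (a * a') (a * b' + b * a') (a * c' + c * a')
           (a * d' + d * a' + b * c' - c * b')) *
  (forall x a b c d : F,
     x *: Grass a b c d = Grass (x * a) (x * b) (x * c) (x * d)) *
  (forall a b c d : F, - Grass a b c d = Grass (- a) (- b) (- c) (- d)).
Proof. by []. Qed.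

Ltac grass_solve :=
  repeat match goal with x : _ |- _ =>
    match type of x with grass _ => destruct x | GRing.Algebra.sort _ => destruct x end end;
  rewrite ?expr0 ?expr1 ?mul1r ?mulN1r ?grassE /=;
  intros; repeat match goal with H : _ /\ _ |- _ => destruct H end;
  simpl in *; subst;
  first [by split; ring | by rewrite /gamma_gr /gamma_gri /tau_gri /= ?grassE; congr Grass; ring].

Lemma G2_gr_0 i : G2_gr i (0 : grass F). Proof. by case: i. Qed.
Lemma G2_gr_lin i (c : F) a b : G2_gr i a -> G2_gr i b -> G2_gr i (c *: a + b).
Proof. case: i; grass_solve. Qed.
Lemma G2_gr_sum (a : grass F) :
  exists a0 a1, [/\ G2_gr false a0, G2_gr true a1 & a = a0 + a1].
Proof.
case: a => a b c d; exists (Grass a 0 0 d), (Grass 0 b c 0).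
by split=> //; congr Grass; rewrite ?addr0 ?add0r.
Qed.
Lemma G2_gr_direct (a : grass F) : G2_gr false a -> G2_gr true a -> a = 0.
Proof. by case: a => a b c d [/= -> ->] [/= -> ->]. Qed.
Lemma G2_gr_mul i j (a b : grass F) :
  G2_gr i a -> G2_gr j b -> G2_gr (i (+) j) (a * b).
Proof. case: i; case: j; grass_solve. Qed.
Lemma gamma_gr_hom i (a : grass F) : G2_gr i a -> G2_gr i (gamma_gr a).
Proof. case: i; grass_solve. Qed.
Lemma gamma_grK : involutive (@gamma_gr F).
Proof. move=> a; grass_solve. Qed.
Lemma gamma_grM i j (a b : grass F) : G2_gr i a -> G2_gr j b ->
  gamma_gr (a * b) = (-1) ^+ (i && j) * (gamma_gr b * gamma_gr a).
Proof. case: i; case: j; grass_solve. Qed.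

Definition G2_gr_gamma : starAlg F :=
  StarAlg (star := @gamma_gr F) G2_gr_0 G2_gr_lin G2_gr_sum G2_gr_direct
    G2_gr_mul gamma_gr_hom gamma_grK gamma_grM.

Lemma G2_gri_0 i : G2_gri i (0 : grass F). Proof. by case: i. Qed.
Lemma G2_gri_lin i (c : F) a b : G2_gri i a -> G2_gri i b -> G2_gri i (c *: a + b).
Proof. case: i; grass_solve. Qed.
Lemma G2_gri_sum (a : grass F) :
  exists a0 a1, [/\ G2_gri false a0, G2_gri true a1 & a = a0 + a1].
Proof.
case: a => a b c d; exists (Grass a b 0 0), (Grass 0 0 c d).
by split=> //; congr Grass; rewrite ?addr0 ?add0r.
Qed.
Lemma G2_gri_direct (a : grass F) : G2_gri false a -> G2_gri true a -> a = 0.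
Proof. by case: a => a b c d [/= -> ->] [/= -> ->]. Qed.
Lemma G2_gri_mul i j (a b : grass F) :
  G2_gri i a -> G2_gri j b -> G2_gri (i (+) j) (a * b).
Proof. case: i; case: j; grass_solve. Qed.
Lemma gamma_gri_hom i (a : grass F) : G2_gri i a -> G2_gri i (gamma_gri a).
Proof. case: i; grass_solve. Qed.
Lemma gamma_griK : involutive (@gamma_gri F).
Proof. move=> a; grass_solve. Qed.
Lemma gamma_griM i j (a b : grass F) : G2_gri i a -> G2_gri j b ->
  gamma_gri (a * b) = (-1) ^+ (i && j) * (gamma_gri b * gamma_gri a).
Proof. case: i; case: j; grass_solve. Qed.
Lemma tau_gri_hom i (a : grass F) : G2_gri i a -> G2_gri i (tau_gri a).
Proof. case: i; grass_solve. Qed.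
Lemma tau_griK : involutive (@tau_gri F).
Proof. move=> a; grass_solve. Qed.
Lemma tau_griM i j (a b : grass F) : G2_gri i a -> G2_gri j b ->
  tau_gri (a * b) = (-1) ^+ (i && j) * (tau_gri b * tau_gri a).
Proof. case: i; case: j; grass_solve. Qed.

Definition G2_gri_gamma : starAlg F :=
  StarAlg (star := @gamma_gri F) G2_gri_0 G2_gri_lin G2_gri_sum G2_gri_direct
    G2_gri_mul gamma_gri_hom gamma_griK gamma_griM.
Definition G2_gri_tau : starAlg F :=
  StarAlg (star := @tau_gri F) G2_gri_0 G2_gri_lin G2_gri_sum G2_gri_direct
    G2_gri_mul tau_gri_hom tau_griK tau_griM.

End StarGrassmann.

Section AlgebraW.
Variable F : fieldType.

(* Matrix units, with rows and columns numbered from 1. *)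
Definition munit (i j : nat) : 'M[F]_4 :=
  \matrix_(k < 4, l < 4) ((k.+1 == i) && (l.+1 == j))%:R.

Definition Wmx (a b c d : F) : 'M[F]_4 :=
  a *: (munit 1 1 + munit 2 2 + munit 3 3 + munit 4 4)
  + b *: (munit 1 2 + munit 3 4) + c *: (munit 1 3 + munit 2 4) + d *: munit 1 4.

(* The coordinates (a, b, c, d) form the first row of Wmx a b c d. *)
Definition inW : {pred 'M[F]_4} :=
  [pred M : 'M[F]_4 | M == Wmx (M 0 0) (M 0 1) (M 0 2) (M 0 3)].

Lemma Wmx_row a b c d : let M := Wmx a b c d in
  [/\ M 0 0 = a, M 0 1 = b, M 0 2 = c & M 0 3 = d].
Proof. by split; rewrite !mxE /=; ring. Qed.

Lemma inWP M : reflect (exists a b c d, M = Wmx a b c d) (M \in inW).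
Proof.
apply: (iffP eqP) => [->|[a [b [c [d ->]]]]]; first by do 4 eexists.
by case: (Wmx_row a b c d) => -> -> -> ->.
Qed.

Lemma Wmx_lin (x a b c d a' b' c' d' : F) :
  x *: Wmx a b c d + Wmx a' b' c' d' =
  Wmx (x * a + a') (x * b + b') (x * c + c') (x * d + d').
Proof. by apply/matrixP => i j; rewrite !mxE; ring. Qed.

Lemma WmxE a b c d (i j : 'I_4) : Wmx a b c d i j =
  nth 0 (nth [::] [:: [:: a; b; c; d]; [:: 0; a; 0; c];
                      [:: 0; 0; a; b]; [:: 0; 0; 0; a]] i) j.
Proof.
case: i j => -[|[|[|[|//]]]] hi -[[|[|[|[|//]]]] hj]; rewrite !mxE /=;
  by rewrite ?(mulr0n, mulr1n, addr0, add0r, mulr0, mulr1).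
Qed.

Lemma Wmx1 : 1 = Wmx 1 0 0 0.
Proof.
apply/matrixP => i j; rewrite WmxE mxE.
by case: i j => -[|[|[|[|//]]]] hi -[[|[|[|[|//]]]] hj].
Qed.

Lemma Wmx_mul (a b c d a' b' c' d' : F) :
  Wmx a b c d * Wmx a' b' c' d' =
  Wmx (a * a') (a * b' + b * a') (a * c' + c * a')
      (a * d' + d * a' + b * c' + c * b').
Proof.
apply/matrixP => i j; rewrite mxE !big_ord_recl big_ord0 !WmxE /=.
case: i j => -[|[|[|[|//]]]] hi -[[|[|[|[|//]]]] hj] /=; ring.
Qed.

Lemma inW_subalg : subalg_closed inW.
Proof.
split=> [|x u v /inWP [a [b [c [d ->]]]] /inWP [a' [b' [c' [d' ->]]]]
         |u v /inWP [a [b [c [d ->]]]] /inWP [a' [b' [c' [d' ->]]]]].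
- by apply/inWP; rewrite Wmx1; do 4 eexists.
- by apply/inWP; rewrite Wmx_lin; do 4 eexists.
- by apply/inWP; rewrite Wmx_mul; do 4 eexists.
Qed.
HB.instance Definition _ := GRing.isSubalgClosed.Build F 'M[F]_4 inW inW_subalg.

Record Walg := MkW { Wval : 'M[F]_4; _ : Wval \in inW }.
HB.instance Definition _ := [isSub for Wval].
HB.instance Definition _ := [Choice of Walg by <:].
HB.instance Definition _ := [SubChoice_isSubAlgebra of Walg by <:].


Implicit Types x y : Walg.

Lemma Wmx_in a b c d : Wmx a b c d \in inW.
Proof. by apply/inWP; do 4 eexists. Qed.

Definition mkW (a b c d : F) : Walg := MkW (Wmx_in a b c d).
Definition wa x : F := val x 0 0.
Definition wb x : F := val x 0 1.
Definition wc x : F := val x 0 2.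
Definition wd x : F := val x 0 3.

Lemma mkWK a b c d :
  (wa (mkW a b c d) = a) * (wb (mkW a b c d) = b) *
  (wc (mkW a b c d) = c) * (wd (mkW a b c d) = d).
Proof. by rewrite /wa /wb /wc /wd /=; case: (Wmx_row a b c d) => -> -> -> ->. Qed.

Lemma WalgE x : x = mkW (wa x) (wb x) (wc x) (wd x).
Proof. by apply/val_inj/eqP; case: x. Qed.

Lemma mkW_add a b c d a' b' c' d' :
  mkW a b c d + mkW a' b' c' d' = mkW (a + a') (b + b') (c + c') (d + d').
Proof.
by apply/val_inj; have := Wmx_lin 1 a b c d a' b' c' d'; rewrite scale1r !mul1r.
Qed.
Lemma mkW0 : 0 = mkW 0 0 0 0.
Proof. by apply/val_inj; rewrite /= /Wmx !scale0r !addr0. Qed.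
Lemma mkW_scale z a b c d : z *: mkW a b c d = mkW (z * a) (z * b) (z * c) (z * d).
Proof. by apply/val_inj; rewrite /= /Wmx !scalerDr !scalerA -!scalerDr. Qed.
Lemma mkW_mul a b c d a' b' c' d' :
  mkW a b c d * mkW a' b' c' d' =
  mkW (a * a') (a * b' + b * a') (a * c' + c * a') (a * d' + d * a' + b * c' + c * b').
Proof. exact/val_inj/Wmx_mul. Qed.
Lemma mkW_opp a b c d : - mkW a b c d = mkW (- a) (- b) (- c) (- d).
Proof. by rewrite -scaleN1r mkW_scale !mulN1r. Qed.

Definition W_gr (i : bool) x : Prop :=
  if i then wa x = 0 /\ wd x = 0 else wb x = 0 /\ wc x = 0.
Definition W_gri (i : bool) x : Prop :=
  if i then wa x = 0 /\ wb x = 0 else wc x = 0 /\ wd x = 0.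

Definition eta1 x := mkW (wa x) (- wb x) (wc x) (- wd x).
Definition eta2 x := mkW (wa x) (- wb x) (wc x) (wd x).
Definition eta3 x := mkW (wa x) (- wb x) (- wc x) (wd x).

Definition mkWE := (mkW_add, mkW_scale, mkW_mul, mkW_opp, mkWK).

Lemma eta1_linear : linear eta1.
Proof.
move=> z x y; rewrite (WalgE x) (WalgE y) /eta1 !mkWE.
by congr mkW; ring.
Qed.
HB.instance Definition _ := GRing.isLinear.Build F Walg Walg *:%R eta1 eta1_linear.
Lemma eta2_linear : linear eta2.
Proof.
move=> z x y; rewrite (WalgE x) (WalgE y) /eta2 !mkWE.
by congr mkW; ring.
Qed.
HB.instance Definition _ := GRing.isLinear.Build F Walg Walg *:%R eta2 eta2_linear.
Lemma eta3_linear : linear eta3.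
Proof.
move=> z x y; rewrite (WalgE x) (WalgE y) /eta3 !mkWE.
by congr mkW; ring.
Qed.
HB.instance Definition _ := GRing.isLinear.Build F Walg Walg *:%R eta3 eta3_linear.

Ltac W_solve1 := rewrite /= ?mkWE;
  let h1 := fresh in let h2 := fresh in
  move=> [h1 h2]; rewrite ?(h1, h2); split; ring.
Ltac W_solve2 := rewrite /= ?mkWE;
  let h1 := fresh in let h2 := fresh in let h3 := fresh in let h4 := fresh in
  move=> [h1 h2] [h3 h4]; rewrite ?(h1, h2, h3, h4); split; ring.
Ltac W_star x y :=
  rewrite (WalgE x) (WalgE y) /eta1 /eta2 /eta3 /= ?expr0 ?expr1 ?mul1r ?mulN1r ?mkWE;
  let h1 := fresh in let h2 := fresh in let h3 := fresh in let h4 := fresh in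
  move=> [h1 h2] [h3 h4]; rewrite ?(h1, h2, h3, h4); congr mkW; ring.

Lemma W_gr_0 i : W_gr i 0.
Proof. by rewrite mkW0; case: i; rewrite /= !mkWE. Qed.
Lemma W_gr_lin i (z : F) x y : W_gr i x -> W_gr i y -> W_gr i (z *: x + y).
Proof. rewrite (WalgE x) (WalgE y); case: i; W_solve2. Qed.
Lemma W_gr_sum x : exists x0 x1, [/\ W_gr false x0, W_gr true x1 & x = x0 + x1].
Proof.
exists (mkW (wa x) 0 0 (wd x)), (mkW 0 (wb x) (wc x) 0).
by split; rewrite /= ?mkWE // {1}(WalgE x) ?addr0 ?add0r.
Qed.
Lemma W_gr_direct x : W_gr false x -> W_gr true x -> x = 0.
Proof. by rewrite (WalgE x) /= !mkWE mkW0 => -[-> ->] [-> ->]. Qed.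
Lemma W_gr_mul i j x y : W_gr i x -> W_gr j y -> W_gr (i (+) j) (x * y).
Proof. rewrite (WalgE x) (WalgE y); case: i; case: j; W_solve2. Qed.
Lemma eta2_hom i x : W_gr i x -> W_gr i (eta2 x).
Proof. rewrite (WalgE x) /eta2; case: i; W_solve1. Qed.
Lemma eta2K : involutive eta2.
Proof. by move=> x; rewrite {2}(WalgE x) /eta2 !mkWE !opprK. Qed.
Lemma eta2M i j x y : W_gr i x -> W_gr j y ->
  eta2 (x * y) = (-1) ^+ (i && j) * (eta2 y * eta2 x).
Proof. case: i; case: j; W_star x y. Qed.

Definition W_gr_eta2 : starAlg F :=
  StarAlg (star := eta2) W_gr_0 W_gr_lin W_gr_sum W_gr_direct W_gr_mul
    eta2_hom eta2K eta2M.

Lemma W_gri_0 i : W_gri i 0.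
Proof. by rewrite mkW0; case: i; rewrite /= !mkWE. Qed.
Lemma W_gri_lin i (z : F) x y : W_gri i x -> W_gri i y -> W_gri i (z *: x + y).
Proof. rewrite (WalgE x) (WalgE y); case: i; W_solve2. Qed.
Lemma W_gri_sum x : exists x0 x1, [/\ W_gri false x0, W_gri true x1 & x = x0 + x1].
Proof.
exists (mkW (wa x) (wb x) 0 0), (mkW 0 0 (wc x) (wd x)).
by split; rewrite /= ?mkWE // {1}(WalgE x) ?addr0 ?add0r.
Qed.
Lemma W_gri_direct x : W_gri false x -> W_gri true x -> x = 0.
Proof. by rewrite (WalgE x) /= !mkWE mkW0 => -[-> ->] [-> ->]. Qed.
Lemma W_gri_mul i j x y : W_gri i x -> W_gri j y -> W_gri (i (+) j) (x * y).
Proof. rewrite (WalgE x) (WalgE y); case: i; case: j; W_solve2. Qed.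
Lemma eta1_hom i x : W_gri i x -> W_gri i (eta1 x).
Proof. rewrite (WalgE x) /eta1; case: i; W_solve1. Qed.
Lemma eta1K : involutive eta1.
Proof. by move=> x; rewrite {2}(WalgE x) /eta1 !mkWE !opprK. Qed.
Lemma eta1M i j x y : W_gri i x -> W_gri j y ->
  eta1 (x * y) = (-1) ^+ (i && j) * (eta1 y * eta1 x).
Proof. case: i; case: j; W_star x y. Qed.
Lemma eta3_hom i x : W_gri i x -> W_gri i (eta3 x).
Proof. rewrite (WalgE x) /eta3; case: i; W_solve1. Qed.
Lemma eta3K : involutive eta3.
Proof. by move=> x; rewrite {2}(WalgE x) /eta3 !mkWE !opprK. Qed.
Lemma eta3M i j x y : W_gri i x -> W_gri j y ->
  eta3 (x * y) = (-1) ^+ (i && j) * (eta3 y * eta3 x).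
Proof. case: i; case: j; W_star x y. Qed.

Definition W_gri_eta1 : starAlg F :=
  StarAlg (star := eta1) W_gri_0 W_gri_lin W_gri_sum W_gri_direct W_gri_mul
    eta1_hom eta1K eta1M.
Definition W_gri_eta3 : starAlg F :=
  StarAlg (star := eta3) W_gri_0 W_gri_lin W_gri_sum W_gri_direct W_gri_mul
    eta3_hom eta3K eta3M.

End AlgebraW.

(* Main.v *)
(* Modulo identities, multiplicity one makes [y z] and [z y] proportional, and
   applying the superinvolution shows that the ratio is 1 or -1; so [A] contains
   [y], [z] of the given types with [z y = +- y z <> 0].  The target algebra has
   a basis [1, p, q, pq] with the same commutation sign.  Substituting
   [a + s b y + t c z + s t d y z] for [a + b p + c q + d pq], where [s] and [t] run
   over the scalars, and comparing the coefficients of [1], [s], [t] and [s t] shows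
   that an identity of [A] vanishes on the target.  The sign decides between the
   Grassmann algebra and [W]. *)
Require Import Defs.
From mathcomp Require Import all_boot all_algebra reals.
From mathcomp Require Import all_fingroup mxrepresentation boolp ring.
From mathcomp.multinomials Require Import -(notations) monalg.

Set Implicit Arguments.
Unset Strict Implicit.
Unset Printing Implicit Defensive.
Import GRing.Theory.
Local Open Scope ring_scope.

(** * Polynomials in two commuting scalars over a noncommutative algebra *)

Section ScalarEvaluation.
Variables (F : fieldType) (A : algType F).
Hypothesis charF : [pchar F] =i pred0.

(** The scalars [0], ..., [n - 1] are distinct in characteristic zero, so their Vandermonde matrix
    is invertible and the vanishing of the sum at these [n] points already isolates every
    coefficient. *)
Lemma power_sum_eq0 (M : lmodType F) n (v : nat -> M) :
  (forall s : F, \sum_(i < n) s ^+ i *: v i = 0) ->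
  forall i, (i < n)%N -> v i = 0.
Proof.
move=> v0 k lt_kn; pose a : 'rV[F]_n := \row_j (j : nat)%:R.
pose V := Vandermonde n a.
have Vu : V \in unitmx.
  rewrite unitmxE det_Vandermonde unitfE; apply/prodf_neq0 => i _.
  apply/prodf_neq0 => j lt_ij; rewrite !mxE -natrB ?(ltnW lt_ij) //.
  by rewrite (pcharf0P _).1 // subn_eq0 -ltnNge.
pose k' := Ordinal lt_kn; rewrite -[k]/(val k').
(* The equations at the nodes [j] are weighted by column [k'] of the inverse matrix; exchanging the
   sums then leaves [v k'] alone. *)
have : \sum_j invmx V j k' *: (\sum_(i < n) V i j *: v i) = 0.
  apply: big1 => j _; rewrite (_ : \sum_(i < n) _ = 0) ?scaler0 //.
  by rewrite -[RHS](v0 (a 0 j)); apply: eq_bigr => i _; rewrite [V i j]mxE.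
have -> : \sum_j invmx V j k' *: (\sum_(i < n) V i j *: v i) =
    \sum_(i < n) (V *m invmx V) i k' *: v i.
  under eq_bigr do rewrite scaler_sumr.
  rewrite exchange_big /=; apply: eq_bigr => i _; rewrite mxE scaler_suml.
  by apply: eq_bigr => j _; rewrite scalerA mulrC.
rewrite mulmxV // (bigD1 k') //= mxE eqxx scale1r big1 ?addr0 // => i ne_ik.
by rewrite mxE (negPf ne_ik) scale0r.
Qed.

(** The outer variable takes the value [t] and the inner one [s]. Only multiples of the unit are
    substituted: they are central, which makes the evaluation multiplicative although [A] need not
    be commutative. *)
Definition scalar_eval (s t : F) (P : {poly {poly A}}) : A :=
  P.[t%:A%:P].[s%:A].

Lemma scalar_evalD s t : {morph scalar_eval s t : P Q / P + Q}.
Proof. by move=> P Q; rewrite /scalar_eval !hornerD. Qed.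

Lemma scalar_eval_sum s t I (r : seq I) (P : I -> {poly {poly A}}) :
  scalar_eval s t (\sum_(i <- r) P i) = \sum_(i <- r) scalar_eval s t (P i).
Proof.
by apply: (big_morph _ (@scalar_evalD s t)); rewrite /scalar_eval !horner0.
Qed.

Lemma scalar_evalM s t : {morph scalar_eval s t : P Q / P * Q}.
Proof.
move=> P Q; have commA (c : F) (a : A) : a * c%:A = c%:A * a.
  by rewrite mulr_algr mulr_algl.
have comm1 (c : F) (p : {poly A}) : GRing.comm p c%:A%:P.
  by apply/polyP => i; rewrite coefMC coefCM commA.
by rewrite /scalar_eval !hornerM_comm //; apply/esym/comm1.
Qed.

(** [power_sum_eq0] is applied once for each variable, first in [t] with [s] fixed, then in [s]. *)
Lemma scalar_eval_eq0 (P : {poly {poly A}}) :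
  (forall s t, scalar_eval s t P = 0) -> P = 0.
Proof.
(* A common bound on the sizes of the inner polynomials gives all inner sums the same range. *)
move=> P0; pose n := (\max_(i < size P) size (P`_i)%R)%N.
have szP j : (size (P`_j)%R <= n)%N.
  case: (ltnP j (size P)) => [lt_j|ge_j]; last by rewrite nth_default ?size_poly0.
  exact: (leq_bigmax (Ordinal lt_j)).
have ev s t : scalar_eval s t P =
    \sum_(j < size P) t ^+ j *: \sum_(i < n) s ^+ i *: P`_j`_i.
  rewrite /scalar_eval [P.[_]]horner_coef horner_sum; apply: eq_bigr => j _.
  rewrite -rmorphXn /= exprZn expr1n (horner_coef_wide (n := n)) /=; last first.
    apply: leq_trans (szP j); apply/leq_sizeP => i ge_i.
    by rewrite coefMC nth_default ?mul0r.
  rewrite scaler_sumr; apply: eq_bigr => i _.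
  by rewrite coefMC exprZn expr1n !mulr_algr scalerA mulrC -scalerA.
apply/polyP => j; apply/polyP => i; rewrite !coef0.
case: (ltnP j (size P)) => [lt_j|ge_j]; last by rewrite [P`_j]nth_default // coef0.
case: (ltnP i n) => [lt_i|ge_i]; last by rewrite nth_default // (leq_trans (szP j)).
apply: (@power_sum_eq0 A n (fun k => P`_j`_k)) lt_i => s.
apply: (@power_sum_eq0 A (size P) (fun l => \sum_(k < n) s ^+ k *: P`_l`_k)) lt_j.
by move=> t; rewrite -[RHS](P0 s t) ev.
Qed.

End ScalarEvaluation.

(** * Units and homogeneous symmetric or skew elements *)

Section StarAlgebra.
Variables (F : fieldType) (A : starAlg F).

(** Write [1 = u0 + u1]. For [b] of degree [i], the element [b * u1 = b - b * u0] has both degree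
    [i] and the opposite degree, so it is zero. With [b = u0] and [b = u1] this gives
    [u1 = 1 * u1 = 0]. *)
Lemma homog1 : homog false (1 : A).
Proof.
have [u0 [u1 [hu0 hu1 e1]]] := homog_sum (1 : A).
have u1_0 i (b : A) : homog i b -> b * u1 = 0.
  move=> hb; have hbu1 : homog i (b * u1).
    have -> : b * u1 = (-1 : F) *: (b * u0) + b.
      by rewrite scaleN1r -{3}[b]mulr1 e1 mulrDr addKr.
    by apply: homog_lin => //; rewrite -[i]addbF; apply: homog_mul.
  have := homog_mul hb hu1; case: i {hb} hbu1 => /= h1 h2.
    exact: homog_direct h2 h1.
  exact: homog_direct h1 h2.
have -> : (1 : A) = u0; last exact: hu0.
by rewrite {1}e1 -[u1]mul1r {1}e1 mulrDl (u1_0 _ _ hu0) (u1_0 _ _ hu1) !addr0.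
Qed.

Lemma star1 : star A 1 = 1.
Proof.
have h := star_homog homog1.
by have := starM homog1 h; rewrite expr0 !mul1r starK mul1r => <-.
Qed.

Lemma hsym_lin i e (c : F) (a b : A) :
  hsym i e a -> hsym i e b -> hsym i e (c *: a + b).
Proof.
move=> [ha sa] [hb sb]; split; first exact: homog_lin.
by rewrite linearP sa sb mulrDr scalerAr.
Qed.

Lemma hsym0 i e : hsym i e (0 : A).
Proof. by split; [apply: homog0 | rewrite linear0 mulr0]. Qed.

Lemma hsymZ i e (c : F) (a : A) : hsym i e a -> hsym i e (c *: a).
Proof. by move=> ha; rewrite -[_ *: _]addr0; apply: hsym_lin => //; apply: hsym0. Qed.

Lemma hsymD i e (a b : A) : hsym i e a -> hsym i e b -> hsym i e (a + b).
Proof. by move=> ha hb; rewrite -[a]scale1r; apply: hsym_lin. Qed.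

Lemma star_hsymM i e j f (a b : A) : hsym i e a -> hsym j f b ->
  star A (a * b) = (-1) ^+ ((i && j) (+) e (+) f) *: (b * a).
Proof.
move=> [ha sa] [hb sb]; rewrite (starM ha hb) sa sb !mulr_sign scaler_sign.
by case: e {sa}; case: f {sb}; case: (i && j); rewrite /= ?(mulNr, mulrN, opprK).
Qed.

End StarAlgebra.

(** * Transfer of identities through coordinates *)

Definition mon_type (t1 t2 : vtype) (d k l : bool) : vtype :=
  ((k && t1.1) (+) (l && t2.1),
   (k && t1.2) (+) (l && t2.2) (+) [&& k, l & (t1.1 && t2.1) (+) d]).

(* [g k l] is the coordinate along [p ^+ k * q ^+ l], where [p] and [q] are
   homogeneous of types [t1] and [t2], [p ^+ 2 = q ^+ 2 = 0] and
   [q * p = (-1) ^+ d * (p * q)]. *)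
Record coordinates (F : fieldType) (B : starAlg F) (t1 t2 : vtype) (d : bool)
    (g : bool -> bool -> B -> F) : Prop := Coordinates {
  coord_lin : forall k l c a b, g k l (c *: a + b) = c * g k l a + g k l b;
  coord1 : forall k l, g k l 1 = (~~ k && ~~ l)%:R;
  coordM00 : forall a b, g false false (a * b) = g false false a * g false false b;
  coordM10 : forall a b, g true false (a * b) =
    g false false a * g true false b + g true false a * g false false b;
  coordM01 : forall a b, g false true (a * b) =
    g false false a * g false true b + g false true a * g false false b;
  coordM11 : forall a b, g true true (a * b) =
    g false false a * g true true b + g true true a * g false false b +
    g true false a * g false true b + (-1) ^+ d * (g false true a * g true false b);
  coord_eq0 : forall a, (forall k l, g k l a = 0) -> a = 0;
  coord_homog : forall i a k l, homog i a -> i != (mon_type t1 t2 d k l).1 ->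
    g k l a = 0;
  coord_star : forall a k l,
    g k l (star B a) = (-1) ^+ (mon_type t1 t2 d k l).2 * g k l a
}.

Section VarMembership.
Variables (F : fieldType) (A B : starAlg F) (t1 t2 : vtype) (d : bool).
Variables (g : bool -> bool -> B -> F) (y z : A).
Hypothesis charF : [pchar F] =i pred0.
Hypothesis coordB : coordinates t1 t2 d g.
Hypotheses (hy : hsym t1.1 t1.2 y) (hz : hsym t2.1 t2.2 z).
Hypotheses (zy : z * y = (-1) ^+ d *: (y * z)) (yz0 : y * z != 0).

Lemma coordZ k l (c : F) (a : B) : g k l (c *: a) = c * g k l a.
Proof.
have g0 : g k l 0 = 0.
  have := coord_lin coordB k l (-1) 0 0.
  by rewrite scaler0 addr0 mulN1r addNr.
by have := coord_lin coordB k l c a 0; rewrite addr0 g0 addr0.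
Qed.

(** If the degrees differ, [coord_homog] applies. If only the symmetry differs, [coord_star] shows
    that the coordinate equals its own opposite, hence is zero in characteristic zero. *)
Lemma coord_hsym i e a k l :
  hsym i e a -> (i, e) != mon_type t1 t2 d k l -> g k l a = 0.
Proof.
move=> [ha sa]; have := coord_star coordB a k l.
have := coord_homog coordB (k := k) (l := l) ha.
case: (mon_type _ _ _ _ _) => j f /= g0; have [ij|/g0 -> //] := eqVneq i j.
rewrite sa ij xpair_eqE eqxx /= (_ : (-1) ^+ e * a = (-1) ^+ e *: a) ?coordZ;
  last by rewrite mulr_sign scaler_sign.
have opp0 (u : F) : u = - u -> u = 0.
  move/eqP; rewrite -addr_eq0 -mulr2n -mulr_natr mulf_eq0.
  by rewrite (pcharf0P _).1 // orbF => /eqP.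
case: e {sa}; case: f; rewrite ?eqxx // !(expr0, expr1) !mulN1r !mul1r => h _.
  by apply: opp0.
by apply: opp0; rewrite -h.
Qed.

Definition mon (k l : bool) : A := y ^+ k * z ^+ l.

Lemma mon_neq0 k l : mon k l != 0.
Proof.
rewrite /mon; case: k; case: l; rewrite ?expr0 ?expr1 ?mulr1 ?mul1r //.
- by apply: contraNneq yz0 => ->; rewrite mul0r.
- by apply: contraNneq yz0 => ->; rewrite mulr0.
- exact: oner_neq0.
Qed.

(** The superinvolution reverses [y * z], with a sign when both factors are odd, and restoring the
    order by [zy] costs [(-1) ^+ d]. These two signs form the last summand in the second component
    of [mon_type]. *)
Lemma hsym_mon k l :
  hsym (mon_type t1 t2 d k l).1 (mon_type t1 t2 d k l).2 (mon k l).
Proof.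
rewrite /mon /mon_type /=; case: k; case: l;
  rewrite ?expr0 ?expr1 ?mulr1 ?mul1r ?addbF //=; last first.
  by split; [apply: homog1 | rewrite star1 mulr1].
split; first exact: homog_mul hy.1 hz.1.
rewrite (star_hsymM hy hz) zy scalerA -signr_addb mulr_sign -scaler_sign.
by congr (_ ^+ _ *: _); case: (_ && _); case: (t1.2); case: (t2.2); case: d.
Qed.

(** The inner variable marks the power of [y] and the outer one the power of [z]. *)
Definition lift (b : B) : {poly {poly A}} :=
  Poly [:: Poly [:: g false false b *: mon false false; g true false b *: mon true false];
           Poly [:: g false true b *: mon false true; g true true b *: mon true true]].

(** Coordinates along monomials of another type vanish, so only scalar multiples of monomials of
    type [(i, e)] remain. This makes [lift] an admissible substitution for every choice of
    scalars. *)
Lemma hsym_lift i e b (s t : F) : hsym i e b -> hsym i e (scalar_eval s t (lift b)).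
Proof.
move=> hb; have hm k l : hsym i e (g k l b *: mon k l).
  have [ie|ne] := eqVneq (mon_type t1 t2 d k l) (i, e).
    by apply: hsymZ; have := hsym_mon k l; rewrite ie.
  by rewrite (coord_hsym hb) 1?eq_sym // scale0r; apply: hsym0.
rewrite /scalar_eval horner_Poly /= mul0r add0r hornerD hornerM_comm; last first.
  by rewrite /comm_poly hornerC mulr_algl mulr_algr.
by rewrite !(hornerC, horner_cons) !mul0r !add0r !mulr_algr;
  repeat first [exact: hm | apply: hsymD | apply: hsymZ].
Qed.

(** The indices are booleans, so coefficients of degree two or more in either variable are ignored.
    This models [p ^+ 2 = q ^+ 2 = 0] in the target, while [y ^+ 2] and [z ^+ 2] may be nonzero in
    [A]. *)
Definition lifts (b : B) (P : {poly {poly A}}) : Prop :=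
  forall k l : bool, P`_l`_k = g k l b *: mon k l.

Lemma lifts_lift b : lifts b (lift b).
Proof. by move=> k l; case: l; case: k; rewrite /lift /= !coef_cons. Qed.

Lemma lifts_lin c a b P Q :
  lifts a P -> lifts b Q -> lifts (c *: a + b) (c%:A%:P%:P * P + Q).
Proof.
move=> hP hQ k l; rewrite !coefD !coefCM hP hQ mulr_algl (coord_lin coordB).
by rewrite scalerDl scalerA.
Qed.

Lemma lifts0 : lifts 0 0.
Proof.
by move=> k l; rewrite !coef0 -[0 in RHS](scale0r 0) coordZ mul0r scale0r.
Qed.

Lemma lifts1 : lifts 1 1.
Proof.
move=> k l; rewrite (coord1 coordB) coef1.
case: l; case: k; rewrite /= ?coef1 ?coef0 ?scale0r //.
by rewrite scale1r /mon !expr0 mulr1.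
Qed.

(** Coefficients of degree at most one in each variable of a product depend only on such
    coefficients of the factors, and they multiply by the rules of [coordinates]; the sign in
    [coordM11] comes from [zy]. *)
Lemma liftsM a b P Q : lifts a P -> lifts b Q -> lifts (a * b) (P * Q).
Proof.
move=> hP hQ k l.
have E (i j i' j' : bool) : P`_j`_i * Q`_j'`_i' =
    (g i j a * g i' j' b) *: (mon i j * mon i' j').
  by rewrite hP hQ -scalerAl -scalerAr scalerA.
have monE (i j : bool) : (mon false false * mon i j = mon i j) *
    (mon i j * mon false false = mon i j).
  by rewrite [mon false false](_ : _ = 1) ?mulr1 ?mul1r // /mon !expr0 mulr1.
have m11 : mon true false * mon false true = mon true true.
  by rewrite /mon !expr0 !expr1 mulr1 mul1r.
have m11' : mon false true * mon true false = (-1) ^+ d *: mon true true.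
  by rewrite /mon !expr0 !expr1 mulr1 mul1r.
case: l; case: k; rewrite coefM !big_ord_recl big_ord0 /= ?addr0 ?coefD;
  rewrite !coefM !big_ord_recl !big_ord0 /= ?addr0.
- rewrite (E false false true true) (E true false false true).
  rewrite (E false true true false) (E true true false false) (coordM11 coordB).
  rewrite !monE m11 m11' scalerA -!scalerDl; congr (_ *: _); ring.
- rewrite (E false false false true) (E false true false false).
  by rewrite (coordM01 coordB) !monE -!scalerDl.
- rewrite (E false false true false) (E true false false false).
  by rewrite (coordM10 coordB) !monE -!scalerDl.
- by rewrite (E false false false false) (coordM00 coordB) !monE.
Qed.

(* Substituting [lift] for each variable of an identity of [A] yields 0 at all
   scalars, hence 0 as a polynomial; its coefficients in degrees at most one are
   the coordinates of the value of the identity in [B]. *)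
Lemma in_var_coordinates : in_var A B.
Proof.
move=> f fA v hv; pose w s t x := scalar_eval s t (lift (v x)).
pose T := \sum_(m <- finmap.enum_fset (msupp f))
  (mcoeff m f)%:A%:P%:P * \prod_(x <- (m : seq svar)) lift (v x).
have T0 : T = 0.
  apply: (scalar_eval_eq0 charF) => s t.
  have <- : eval (w s t) f = scalar_eval s t T.
    rewrite /eval /mmap scalar_eval_sum; apply: eq_bigr => m _.
    rewrite scalar_evalM; congr (_ * _); first by rewrite /scalar_eval !hornerC.
    symmetry; apply: (big_morph _ (@scalar_evalM _ _ s t)).
    by rewrite /scalar_eval !hornerC.
  by apply: fA => x; apply: hsym_lift; apply: hv.
have hT : lifts (eval v f) T.
  rewrite /T /eval /mmap; elim: (finmap.enum_fset _) => [|m r IH].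
    by rewrite !big_nil; apply: lifts0.
  rewrite !big_cons mulr_algl; apply: lifts_lin IH.
  elim: (m : seq svar) => [|x u IHu]; first by rewrite !big_nil; apply: lifts1.
  by rewrite !big_cons; apply: liftsM IHu; apply: lifts_lift.
apply: (coord_eq0 coordB) => k l; apply/eqP.
have := hT k l; rewrite T0 !coef0 => /esym/eqP.
by rewrite scaler_eq0 (negPf (mon_neq0 k l)) orbF.
Qed.

End VarMembership.

(** * Coordinates on the six target algebras *)

Section Coordinates.
Variable F : fieldType.

Ltac solve_G2_gri := split=> /=;
  [ by case; case
  | by case; case
  | by []
  | by []
  | by []
  | by move=> a b; rewrite expr1; ring
  | by case=> a b c e h; congr Grass; [have := h false false | have := h true false
      | have := h false true | have := h true true]
  | by case=> a [] [] //= [h1 h2]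
  | by move=> a; case; case; rewrite /= ?expr0 ?expr1; ring ].

(** Here [p] is [e1] and [q] is [e2], which anticommute, whence the sign [true]. *)
Lemma G2_gri_gamma_coordinates :
  @coordinates F (G2_gri_gamma F) even_skew odd_sym true (fun k l =>
    if k then if l then @gc12 F else @gc1 F else if l then @gc2 F else @gc0 F).
Proof. solve_G2_gri. Qed.

Lemma G2_gri_tau_coordinates :
  @coordinates F (G2_gri_tau F) even_skew odd_skew true (fun k l =>
    if k then if l then @gc12 F else @gc1 F else if l then @gc2 F else @gc0 F).
Proof. solve_G2_gri. Qed.

(* Here [p] is [e2] and [q] is [e1], so that [p * q] is [- (e1 * e2)]. *)
Lemma G2_gr_gamma_coordinates :
  @coordinates F (G2_gr_gamma F) odd_sym odd_skew true (fun k l =>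
    if k then if l then fun a => - gc12 a else @gc2 F
    else if l then @gc1 F else @gc0 F).
Proof.
split=> /=.
- by case; case=> c a b /=; ring.
- by case; case; rewrite /= ?oppr0.
- by [].
- by [].
- by [].
- by move=> a b; rewrite expr1; ring.
- by case=> a b c e h; congr Grass; [have := h false false | have := h false true
    | have := h true false | have := h true true => /eqP; rewrite oppr_eq0 => /eqP].
- by case=> a [] [] //= [h1 h2] _; rewrite ?h2 ?oppr0.
- by move=> a; case; case; rewrite /= ?expr0 ?expr1; ring.
Qed.

Lemma W_coord_lin (c : F) (a b : Walg F) :
  (wa (c *: a + b) = c * wa a + wa b) * (wb (c *: a + b) = c * wb a + wb b) *
  (wc (c *: a + b) = c * wc a + wc b) * (wd (c *: a + b) = c * wd a + wd b).
Proof. by rewrite (WalgE a) (WalgE b) !mkWE. Qed.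

Lemma W_coord1 :
  (wa (1 : Walg F) = 1) * (wb (1 : Walg F) = 0) *
  (wc (1 : Walg F) = 0) * (wd (1 : Walg F) = 0).
Proof.
have -> : 1 = mkW 1 0 0 0 :> Walg F by apply/val_inj/Wmx1.
by rewrite !mkWE.
Qed.

Lemma W_coordM (a b : Walg F) :
  (wa (a * b) = wa a * wa b) * (wb (a * b) = wa a * wb b + wb a * wa b) *
  (wc (a * b) = wa a * wc b + wc a * wa b) *
  (wd (a * b) = wa a * wd b + wd a * wa b + wb a * wc b + wc a * wb b).
Proof. by rewrite (WalgE a) (WalgE b) !mkWE. Qed.

Lemma W_coord_eq0 (a : Walg F) : wa a = 0 -> wb a = 0 -> wc a = 0 -> wd a = 0 -> a = 0.
Proof. by rewrite (WalgE a) mkW0 !mkWE => -> -> -> ->. Qed.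

(** Here [p] is [e12 + e34] and [q] is [e13 + e24]. Both products [p * q] and [q * p] equal [e14],
    whence the sign [false]. *)
Lemma W_gri_eta1_coordinates :
  @coordinates F (W_gri_eta1 F) even_skew odd_sym false (fun k l =>
    if k then if l then @wd F else @wb F else if l then @wc F else @wa F).
Proof.
split=> /=.
- by case; case=> c a b; rewrite W_coord_lin.
- by case; case; rewrite W_coord1.
- by move=> a b; rewrite W_coordM.
- by move=> a b; rewrite W_coordM.
- by move=> a b; rewrite W_coordM.
- by move=> a b; rewrite W_coordM; ring.
- move=> a h; apply: W_coord_eq0;
    [exact: (h false false) | exact: (h true false)
    | exact: (h false true) | exact: (h true true)].
- by case=> a [] [] //= [h1 h2].
- by move=> a; case; case; rewrite /= /eta1 !mkWE ?expr0 ?expr1; ring.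
Qed.

Lemma W_gri_eta3_coordinates :
  @coordinates F (W_gri_eta3 F) even_skew odd_skew false (fun k l =>
    if k then if l then @wd F else @wb F else if l then @wc F else @wa F).
Proof.
split=> /=.
- by case; case=> c a b; rewrite W_coord_lin.
- by case; case; rewrite W_coord1.
- by move=> a b; rewrite W_coordM.
- by move=> a b; rewrite W_coordM.
- by move=> a b; rewrite W_coordM.
- by move=> a b; rewrite W_coordM; ring.
- move=> a h; apply: W_coord_eq0;
    [exact: (h false false) | exact: (h true false)
    | exact: (h false true) | exact: (h true true)].
- by case=> a [] [] //= [h1 h2].
- by move=> a; case; case; rewrite /= /eta3 !mkWE ?expr0 ?expr1; ring.
Qed.

(** Both generators are odd and [eta2] fixes [e13 + e24] but negates [e12 + e34], so [p] is now
    [e13 + e24] and the coordinates [wb] and [wc] change places. *)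
Lemma W_gr_eta2_coordinates :
  @coordinates F (W_gr_eta2 F) odd_sym odd_skew false (fun k l =>
    if k then if l then @wd F else @wc F else if l then @wb F else @wa F).
Proof.
split=> /=.
- by case; case=> c a b; rewrite W_coord_lin.
- by case; case; rewrite W_coord1.
- by move=> a b; rewrite W_coordM.
- by move=> a b; rewrite W_coordM.
- by move=> a b; rewrite W_coordM.
- by move=> a b; rewrite W_coordM; ring.
- move=> a h; apply: W_coord_eq0;
    [exact: (h false false) | exact: (h false true)
    | exact: (h true false) | exact: (h true true)].
- by case=> a [] [] //= [h1 h2].
- by move=> a; case; case; rewrite /= /eta2 !mkWE ?expr0 ?expr1; ring.
Qed.

End Coordinates.

(** * Evaluation of noncommutative polynomials *)

Section FreeAlgebra.
Variable F : fieldType.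
Implicit Types (f : freeAlg F) (x : svar).

Lemma scale_mkmalgU (c a : F) (m : fmonom svar) :
  c *: mkmalgU m a = mkmalgU m (c * a) :> freeAlg F.
Proof. by apply/malgP => k; rewrite mcoeffZ !mcoeffU mulrnAr. Qed.

Lemma evalD (B : lalgType F) (v : svar -> B) : {morph eval v : f g / f + g}.
Proof. by move=> f g; apply: (mmapD (f := in_alg B)). Qed.

Lemma eval_scale (B : lalgType F) (v : svar -> B) c f :
  eval v (c *: f) = c *: eval v f.
Proof.
have eval0 : eval v 0 = 0 by apply: (mmap0 (f := in_alg B)).
(* The multiple [c *: f] is expanded over the support of [f], so [c = 0] needs no separate
   treatment. *)
rewrite malgZ_def /fgscale (big_morph _ (evalD v) eval0) [in RHS]/eval mmapE scaler_sumr.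
by apply: eq_bigr => m _; rewrite /eval (mmapU (f := in_alg B)) !mulr_algl scalerA.
Qed.

Lemma eval_lin (B : lalgType F) (v : svar -> B) c f h :
  eval v (c *: f + h) = c *: eval v f + eval v h.
Proof. by rewrite evalD eval_scale. Qed.

Lemma eval_X2 (B : lalgType F) (v : svar -> B) x1 x2 :
  eval v (X F x1 * X F x2) = v x1 * v x2.
Proof.
rewrite /eval /X malgM_def fgmulUU (mmapU (f := in_alg B)) /= mulr1 scale1r mul1r.
by rewrite fmM !fmU !big_cons big_nil mulr1.
Qed.

Lemma eval_X f : eval (X F) f = f.
Proof.
rewrite [RHS]monalgE; apply: eq_bigr => m _; rewrite mulr_algl.
have -> : \prod_(x <- (m : seq svar)) X F x = mkmalgU m 1.
  case: m => s /=; elim: s => [|x s IH]; first by rewrite big_nil /= -fmoneE.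
  rewrite big_cons IH /X malgM_def fgmulUU mulr1; congr mkmalgU.
  by apply: val_inj; rewrite /= fmM fmU.
by rewrite scale_mkmalgU mulr1.
Qed.

End FreeAlgebra.

(** * Partitions and Specht characters in degree at most one *)

Lemma partitions_eq n la :
  (n <= 1)%N -> is_partition n la -> partitions n = [:: la].
Proof.
move=> n1 lan; apply: perm_small_eq => //; apply: uniq_perm => // [|mu].
  exact: partitions_uniq.
rewrite mem_partitions inE.
(* Parts are positive, so two of them would sum to at least 2. *)
have uniq1 (l : seq nat) : is_partition n l -> l = nseq n 1%N.
  case/and3P=> _ l0 /eqP sl; have l1 x : x \in l -> (0 < x)%N.
    by move=> xl; rewrite lt0n; apply: contraNneq l0 => <-.
  case: l l1 sl {l0} => [|x [|x' l]] /= l1 sl; first by rewrite -sl.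
    have := l1 x; rewrite inE eqxx => /(_ isT).
    by move: n1; rewrite -sl addn0; case: x {l1 sl} => [|[]].
  have := l1 x; have := l1 x'; rewrite !inE !eqxx orbT => /(_ isT) x'0 /(_ isT) x0.
  by move: n1; rewrite -sl addnA leqNgt (leq_trans (leq_add x0 x'0)) ?leq_addr.
apply/idP/eqP => [mun|-> //].
by rewrite (uniq1 _ mun) (uniq1 _ lan).
Qed.

Section TrivialSpecht.
Variables (F : fieldType) (n : nat) (la : seq nat).
Hypothesis n_le1 : (n <= 1)%N.

Lemma perm_le1 (s : 'S_n) : s = 1%g.
Proof.
case: n n_le1 s => [|[|//]] _ s; apply/permP => i; first by case: i.
by rewrite [LHS]ord1 [RHS]ord1.
Qed.

Lemma young_sym_le1 :
  young_sym F n la = delta_mx 0 (gring_index [set: 'S_n]%G 1%g).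
Proof.
have stab1 (D : {set 'S_n}) : 1%g \in D -> D = [set 1%g].
  by move=> D1; apply/setP => s; rewrite (perm_le1 s) D1 inE eqxx.
have row1 : row_stab n la = [set 1%g].
  by apply: stab1; rewrite inE; apply/forallP => i; rewrite perm1.
have col1 : col_stab n la = [set 1%g].
  by apply: stab1; rewrite inE; apply/forallP => i; rewrite perm1.
by rewrite /young_sym row1 col1 !big_set1 odd_perm1 expr0 scale1r mulg1.
Qed.

(** The value at the identity is the dimension of the module. The group is trivial, so the regular
    module is a line, and the nonzero Young symmetrizer generates it. *)
Lemma specht_char_id : specht_char F la (1%g : 'S_n) = 1.
Proof.
rewrite /specht_char repr_mx1 mxtrace1.
suff -> : \rank (cyclic_mx (regular_repr F [set: 'S_n]%G) (young_sym F n la)) = 1%N by [].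
have cS : #|[set: 'S_n]%G| = 1%N.
  by apply/eqP/cards1P; exists 1%g; apply/setP => s; rewrite (perm_le1 s) !inE eqxx.
apply/eqP; rewrite eqn_leq -{1}cS rank_leq_col lt0n mxrank_eq0 cyclic_mx_eq0.
rewrite young_sym_le1; apply/eqP => /matrixP/(_ 0 (gring_index [set: 'S_n]%G 1%g)).
by rewrite !mxE !eqxx => /eqP; rewrite oner_eq0.
Qed.

End TrivialSpecht.

(** * From multiplicity one to a quotient of dimension one *)

Lemma rename1 (F : fieldType) n1 n2 n3 n4 (f : freeAlg F) :
  rename ((1, 1, 1, 1)%g : prodS n1 n2 n3 n4) f = f.
Proof.
have block1 k n i : block_perm k (1%g : 'S_n) i = i.
  rewrite /block_perm; case: leqP => // le_ki.
  by case: insubP => // j _ /= ji; rewrite perm1 ji subnKC.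
rewrite -[RHS]eval_X /rename; congr (eval _ f); apply/funext => -[i [[] []]] /=;
  by rewrite block1.
Qed.

(** Since [g] fixes every vector, [rho g] and the identity matrix describe the same action modulo
    [W]. Freeness of the basis makes them equal, so the trace is [d]. *)
Lemma quotient_character_dim (F : fieldType) (M : lmodType F) (G : Type)
    (act : G -> M -> M) (V W : M -> Prop) (chi : G -> F) (g : G) :
  quotient_character act V W chi -> (forall u, act g u = u) ->
  exists2 d, quotient_dim V W d & chi g = d%:R.
Proof.
case=> d [v [rho [basis actE ->]]] g1; exists d; first by exists v.
have [_ _ free] := basis.
suff -> : rho g = 1%:M by rewrite mxtrace1.
apply/matrixP => i j; apply/esym/subr0_eq.
apply: (free (fun k => 1%:M k j - rho g k j)).
suff -> : \sum_k (1%:M k j - rho g k j) *: v k = act g (v j) - \sum_k rho g k j *: v k.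
  exact: actE.
rewrite g1; under eq_bigr do rewrite scalerBl.
rewrite sumrB (bigD1 j) //= mxE eqxx scale1r big1 ?addr0 // => k kj.
by rewrite mxE (negPf kj) scale0r.
Qed.

(** Each degree is at most one, so the cocharacter has a single summand and its value at the
    identity is the multiplicity. Thus [d%:R = 1] in [F], and characteristic zero gives [d = 1]. *)
Lemma proper_mult1_dim (F : fieldType) (A : starAlg F) l1 l2 l3 l4 :
  [pchar F] =i pred0 ->
  all (fun l => is_partition (sumn l) l && (sumn l <= 1)%N) [:: l1; l2; l3; l4] ->
  proper_mult A l1 l2 l3 l4 1 ->
  quotient_dim (@Gamma F (sumn l1) (sumn l2) (sumn l3) (sumn l4))
    (fun f => Gamma (sumn l1) (sumn l2) (sumn l3) (sumn l4) f /\ Id_star A f) 1.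
Proof.
move=> charF /= /and5P[/andP[p1 s1] /andP[p2 s2] /andP[p3 s3] /andP[p4 s4] _] [m + m1].
case/(quotient_character_dim (g := ((1, 1, 1, 1)%g : prodS _ _ _ _))) => [f|d dimd].
  exact: rename1.
rewrite (partitions_eq s1 p1) (partitions_eq s2 p2) (partitions_eq s3 p3).
rewrite (partitions_eq s4 p4) !big_seq1 !specht_char_id // m1 !mulr1 => /esym/eqP.
by rewrite -subr_eq0; case: d dimd => [|[|d]] //;
  rewrite ?sub0r ?oppr_eq0 ?oner_eq0 // -natrB // (pcharf0P _).1.
Qed.

(** * Two elements commuting up to sign *)

Section MultiplicityOne.
Variables (F : fieldType) (A : starAlg F) (x1 x2 : svar).
Variables (V : freeAlg F -> Prop) (p12 p21 : freeAlg F).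
Hypothesis eval12 : forall w : svar -> A, eval w p12 = w x1 * w x2.
Hypothesis eval21 : forall w : svar -> A, eval w p21 = w x2 * w x1.
Hypothesis dimV : quotient_dim V (fun f => V f /\ Id_star A f) 1.
Hypotheses (V12 : V p12) (V21 : V p21).
Hypothesis genV : forall f, V f -> exists c1 c2, f = c1 *: p12 + c2 *: p21.

(** Some substitution gives the generator of the quotient a nonzero value [c]. Then
    [y * z = a1 *: c] and [z * y = a2 *: c], and it remains to compare [a1] with [a2]. *)
Lemma exists_sign_commuting : exists (d : bool) (y z : A),
  [/\ hsym x1.2.1 x1.2.2 y, hsym x2.2.1 x2.2.2 z,
      z * y = (-1) ^+ d *: (y * z) & y * z != 0].
Proof.
have [v [Vv span free]] := dimV.
have nId : ~ Id_star A (v 0).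
  move=> Id0; have /eqP : (1 : F) = 0; last by rewrite oner_eq0.
  by apply: (free (fun=> 1) _ 0); rewrite big_ord1 scale1r.
have {}nId : exists2 w : svar -> A, star_subst w & eval w (v 0) <> 0.
  by apply: contrapT => no; apply: nId => w hw; apply: contrapT => ne; apply: no; exists w.
have [w hw V0] := nId; have [c cE] : exists c, c = eval w (v 0) by exists (eval w (v 0)).
rewrite -cE in V0.
have mulc f : V f -> exists a, eval w f = a *: c.
  move=> /span[a [_ /(_ w hw)]]; rewrite big_ord1 -scaleNr addrC eval_lin scaleNr addrC -cE.
  by move/subr0_eq=> fE; exists (a 0).
have [a1 e12] := mulc _ V12; have [a2 e21] := mulc _ V21.
rewrite eval12 in e12; rewrite eval21 in e21.
have [c1 [c2 vE]] := genV (Vv 0).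
have {}cE : c = (c1 * a1 + c2 * a2) *: c.
  by rewrite {1}cE vE eval_lin eval_scale eval12 eval21 e12 e21 !scalerA scalerDl.
(* The generator is a combination of [p12] and [p21], so [c] would vanish together with both of
   their values. *)
have nz : ~~ ((a1 == 0) && (a2 == 0)).
  apply/negP => /andP[/eqP a10 /eqP a20]; apply: V0.
  by rewrite cE a10 a20 !mulr0 addr0 scale0r.
pose y := w x1; pose z := w x2; pose s := (x1.2.1 && x2.2.1) (+) x1.2.2 (+) x2.2.2.
have s12 : a1 *: star A c = (-1) ^+ s *: (a2 *: c).
  by rewrite -linearZ -e12 (star_hsymM (hw x1) (hw x2)) e21.
have s21 : a2 *: star A c = (-1) ^+ s *: (a1 *: c).
  rewrite -linearZ -e21 (star_hsymM (hw x2) (hw x1)) e12.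
  by rewrite /s andbC addbAC.
(* The superinvolution exchanges the two products up to the same sign, so [s12] and [s21] combine to
   kill [(a1 ^+ 2 - a2 ^+ 2) *: star A c], where [star A c] is nonzero because [star] is
   injective. *)
have sq : a1 ^+ 2 = a2 ^+ 2.
  apply/eqP; rewrite -subr_eq0.
  have : (a1 ^+ 2 - a2 ^+ 2) *: star A c = 0.
    rewrite scalerBl !expr2 -!scalerA s12 s21 !scalerA.
    by rewrite ![_ * (-1) ^+ s]mulrC -!mulrA [a2 * _]mulrC subrr.
  move/eqP; rewrite scaler_eq0 => /orP[//|/eqP sc0].
  by case: V0; rewrite -[c](starK (s := A)) sc0 linear0.
have a10 : a1 != 0.
  apply: contraNneq nz => a10; rewrite a10 eqxx /=.
  by move/eqP: sq; rewrite a10 expr0n eq_sym expf_eq0.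
move/eqP: sq; rewrite eq_sym eqf_sqr => sq.
(* The sign is [-1] exactly when [a2] differs from [a1], and then [a2 = - a1]. *)
exists (a2 != a1), y, z; split; [exact: hw | exact: hw | | ].
  rewrite /y /z e12 e21; case: eqVneq sq => [-> _|_ /eqP ->] /=.
    by rewrite expr0 scale1r.
  by rewrite expr1 scaleN1r scaleNr.
by rewrite /y /z e12 scaler_eq0 negb_or a10; apply/eqP.
Qed.

End MultiplicityOne.

(** * Proper multilinear polynomials of degree two *)

Lemma in_span_gen (F : fieldType) (M : lmodType F) (S : M -> Prop) (u : M) :
  S u -> in_span S u.
Proof.
by move=> Su; exists 1%N, (fun=> 1), (fun=> u); split=> //; rewrite big_ord1 scale1r.
Qed.

Lemma in_span_sub (F : fieldType) (M : lmodType F) (S : M -> Prop) (p q : M) :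
  S p -> S (p - q) -> in_span S q.
Proof.
move=> Sp Spq; exists 2%N, (fun i => (-1) ^+ (i : nat)).
exists (fun i => if i == 0 then p else p - q); split=> [i|]; first by case: ifP.
rewrite !big_ord_recl big_ord0 /= expr0 expr1 scale1r scaleN1r addr0.
by rewrite opprB addrC subrK.
Qed.

Lemma in_span_pair (F : fieldType) (M : lmodType F) (S : M -> Prop) (p q f : M) :
  (forall u, S u -> u = p \/ u = q) -> in_span S f ->
  exists c1 c2, f = c1 *: p + c2 *: q.
Proof.
move=> Spq [k [c [v [Sv ->]]]]; elim/big_rec: _ => [|i _ _ [c1 [c2 ->]]].
  by exists 0, 0; rewrite !scale0r addr0.
have [->|->] := Spq _ (Sv i).
  by exists (c i + c1), c2; rewrite scalerDl addrA.
by exists c1, (c i + c2); rewrite scalerDl addrCA.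
Qed.

Section Degree2.
Variables (F : fieldType) (n1 n2 n3 n4 : nat) (x1 x2 : svar).
Hypothesis varsE : gamma_vars n1 n2 n3 n4 = [:: x1; x2].
Hypothesis types12 : exists u v w : seq svar,
  [/\ all (fun x => x.2 == even_skew) u, all (fun x => x.2 == odd_sym) v,
      all (fun x => x.2 == odd_skew) w & u ++ v ++ w = [:: x1; x2]].

Lemma word2 (a b : svar) : word F [:: a; b] = X F a * X F b.
Proof. by rewrite /word !big_cons big_nil mulr1. Qed.

Lemma perm2 (s : seq svar) : perm_eq s [:: x1; x2] -> s = [:: x1; x2] \/ s = [:: x2; x1].
Proof.
move=> sP; have := perm_size sP; case: s sP => [|a [|b []]] // sP _.
have := perm_mem sP a; rewrite !inE eqxx /= => /esym/orP[]/eqP e; subst a.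
  by left; move: sP; rewrite perm_cons => /perm_small_eq ->.
right; have : perm_eq [:: x2; b] [:: x2; x1].
  by rewrite (perm_trans sP) // (perm_catC [:: x1] [:: x2]).
by rewrite perm_cons => /perm_small_eq ->.
Qed.

Lemma proper12 : proper_product (X F x1 * X F x2).
Proof.
have [u [v [w [hu hv hw e]]]] := types12.
(* The variables already stand in the order that a proper product prescribes, so the list of
   commutators is empty. *)
exists u, v, w, [::]; split; [exact: hu | exact: hv | exact: hw | by [] |].
by rewrite -word2 -e big_nil mulr1 /word !big_cat /= mulrA.
Qed.

Lemma Gamma12 : Gamma n1 n2 n3 n4 (X F x1 * X F x2).
Proof.
rewrite /Gamma varsE; split; last exact: in_span_gen proper12.
by apply: in_span_gen; exists [:: x1; x2]; rewrite ?word2.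
Qed.

Lemma Gamma21 : Gamma n1 n2 n3 n4 (X F x2 * X F x1).
Proof.
rewrite /Gamma varsE; split.
  apply: in_span_gen; exists [:: x2; x1]; rewrite ?word2 //.
  exact/permPl/(perm_catC [:: x2] [:: x1]).
(* The reversed product is [x1 x2 - [x1, x2]], a difference of two proper products. *)
apply: in_span_sub proper12 _.
exists [::], [::], [::], [:: [:: x1; x2]]; split; [by [] | by [] | by [] | by [] |].
by rewrite big_seq1 /word big_nil 3!mul1r.
Qed.

Lemma Gamma_gen f : Gamma n1 n2 n3 n4 f ->
  exists c1 c2, f = c1 *: (X F x1 * X F x2) + c2 *: (X F x2 * X F x1).
Proof.
case=> + _; rewrite varsE; apply: in_span_pair => _ [s /perm2 sE ->].
by case: sE => ->; rewrite word2; [left | right].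
Qed.

End Degree2.

(** Common form of the three cases: [B] is the target with anticommuting generators and [B'] the one
    with commuting generators, and the sign found in [A] selects between them. *)
Lemma mult1_in_var (F : fieldType) (A B B' : starAlg F) l1 l2 l3 l4 x1 x2 g g' :
  [pchar F] =i pred0 ->
  all (fun l => is_partition (sumn l) l && (sumn l <= 1)%N) [:: l1; l2; l3; l4] ->
  gamma_vars (sumn l1) (sumn l2) (sumn l3) (sumn l4) = [:: x1; x2] ->
  (exists u v w : seq svar,
    [/\ all (fun x => x.2 == even_skew) u, all (fun x => x.2 == odd_sym) v,
        all (fun x => x.2 == odd_skew) w & u ++ v ++ w = [:: x1; x2]]) ->
  @coordinates F B x1.2 x2.2 true g -> @coordinates F B' x1.2 x2.2 false g' ->
  proper_mult A l1 l2 l3 l4 1 -> in_var A B \/ in_var A B'.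
Proof.
move=> charF l_le1 vars prop cB cB' /(proper_mult1_dim charF l_le1) dim1.
have [d [y [z [hy hz zy yz0]]]] :=
  exists_sign_commuting (fun w => eval_X2 w x1 x2) (fun w => eval_X2 w x2 x1) dim1
    (Gamma12 F vars prop) (Gamma21 F vars prop) (Gamma_gen vars).
case: d zy => zy; [left | right].
  exact: in_var_coordinates charF cB hy hz zy yz0.
exact: in_var_coordinates charF cB' hy hz zy yz0.
Qed.

Local Close Scope ring_scope.

Theorem lemma4p5 (F : fieldType) (R : realType) (A : starAlg F) :
  [pchar F]%R =i pred0 ->
  type_F_plus_J A ->
  quadratic_growth R A ->
  [/\ proper_mult A [::] [:: 1] [:: 1] [::] 1 ->
        in_var A (G2_gri_gamma F) \/ in_var A (W_gri_eta1 F),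
      proper_mult A [::] [::] [:: 1] [:: 1] 1 ->
        in_var A (G2_gr_gamma F) \/ in_var A (W_gr_eta2 F)
    & proper_mult A [::] [:: 1] [::] [:: 1] 1 ->
        in_var A (G2_gri_tau F) \/ in_var A (W_gri_eta3 F)].
Proof.
move=> charF _ _; split.
(* The indices 0 and 1 are those of [gamma_vars], which numbers the variables consecutively across
   the four blocks. *)
- apply: (@mult1_in_var F A _ _ [::] [:: 1%N] [:: 1%N] [::]
    (0%N, even_skew) (1%N, odd_sym) _ _ charF isT erefl _
    (G2_gri_gamma_coordinates F) (W_gri_eta1_coordinates F)).
  by exists [:: (0%N, even_skew)], [:: (1%N, odd_sym)], [::].
- apply: (@mult1_in_var F A _ _ [::] [::] [:: 1%N] [:: 1%N]
    (0%N, odd_sym) (1%N, odd_skew) _ _ charF isT erefl _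
    (G2_gr_gamma_coordinates F) (W_gr_eta2_coordinates F)).
  by exists [::], [:: (0%N, odd_sym)], [:: (1%N, odd_skew)].
- apply: (@mult1_in_var F A _ _ [::] [:: 1%N] [::] [:: 1%N]
    (0%N, even_skew) (1%N, odd_skew) _ _ charF isT erefl _
    (G2_gri_tau_coordinates F) (W_gri_eta3_coordinates F)).
  by exists [:: (0%N, even_skew)], [::], [:: (1%N, odd_skew)].
Qed.
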